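(* Let $P$ be a probability measure over $\mathbb{R}^d$. Let $(\alpha_n)$ be a sequence in $[0,1)$ that converges to one and let $(u_n)$ be a sequence in $\mathcal{S}^{d-1}$ that converges to $u$. Assume that $P$ is not concentrated on a line with direction $u$ or that $$\int_{\mathbb{R}^d}(\|z\|+u'z)\,dP(z)=\infty.$$ Then, for any sequence $(\mu_{\alpha_n,u_n})$ such that, for each $n$, $\mu_{\alpha_n,u_n}$ is a spatial quantile of order $\alpha_n$ in direction $u_n$ for $P$, one has $\mu_{\alpha_n,u_n}/\|\mu_{\alpha_n,u_n}\|\to u$ as $n\to\infty$.
   Context: $\|\cdot\|$ is the Euclidean norm on $\mathbb{R}^d$, $x'y$ is the Euclidean inner product, and $\mathcal{S}^{d-1}=\{z\in\mathbb{R}^d:\|z\|=1\}$ is the unit sphere. For a probability measure $P$ over $\mathbb{R}^d$, $\alpha\in[0,1)$ and $u\in\mathcal{S}^{d-1}$, a point $\mu_{\alpha,u}\in\mathbb{R}^d$ is a spatial quantile of order $\alpha$ in direction $u$ for $P$ if and only if it minimizes over $\mathbb{R}^d$ the objective function $\mu\mapsto O^P_{\alpha,u}(\mu):=\int_{\mathbb{R}^d}\{\|z-\mu\|-\|z\|-\alpha u'\mu\}\,dP(z)$ (such minimizers need not be unique). $P$ is concentrated on a line with direction $u\in\mathcal{S}^{d-1}$ if and only if there exists $z_0\in\mathbb{R}^d$ such that $P[\{z_0+\lambda u:\lambda\in\mathbb{R}\}]=1$. The integrand $\|z\|+u'z$ is nonnegative, so its integral is well defined in $[0,\infty]$. *)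

(* Defs.v *)
From HB Require Import structures.
From mathcomp Require Import all_boot all_order all_algebra.
From mathcomp Require Import all_classical all_reals all_analysis.

Set Implicit Arguments.
Unset Strict Implicit.
Unset Printing Implicit Defensive.

Import Order.TTheory GRing.Theory Num.Theory.
Import numFieldNormedType.Exports.

Local Open Scope classical_set_scope.
Local Open Scope ring_scope.

(* R^d carries the Borel sigma-algebra, generated by the open sets of the
   library's topology on row vectors.  That topology comes from the sup norm,
   hence coincides with the Euclidean one. *)
Notation borel_rV R d := (g_sigma_algebraType (@open 'rV[R]_d)).

Definition dotp (R : realType) (d : nat) (x y : 'rV[R]_d) : R :=
  \sum_(i < d) x 0 i * y 0 i.

(* The library norm `|z| on 'rV[R]_d is the sup norm, so the Euclidean norm
   has to be defined separately. *)
Definition enorm (R : realType) (d : nat) (z : 'rV[R]_d) : R :=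
  Num.sqrt (dotp z z).

Definition unit_sphere (R : realType) (d : nat) : set 'rV[R]_d :=
  [set z | enorm z = 1].

Definition quantile_objective (R : realType) (d : nat)
    (P : probability (borel_rV R d) R) (alpha : R) (u mu : 'rV[R]_d) : \bar R :=
  (\int[P]_z (enorm (z - mu) - enorm z - alpha * dotp u mu)%:E)%E.

Definition is_spatial_quantile (R : realType) (d : nat)
    (P : probability (borel_rV R d) R) (alpha : R) (u mu : 'rV[R]_d) : Prop :=
  forall nu : 'rV[R]_d,
    (quantile_objective P alpha u mu <= quantile_objective P alpha u nu)%E.

Definition concentrated_on_line (R : realType) (d : nat)
    (P : probability (borel_rV R d) R) (u : 'rV[R]_d) : Prop :=
  exists z0 : 'rV[R]_d, P [set z0 + lambda *: u | lambda in [set: R]] = 1%E.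

(* Main.v *)
Require Import Defs.
From mathcomp Require Import all_boot all_order all_algebra.
From mathcomp Require Import all_classical all_reals all_analysis.
From mathcomp Require Import measurable_realfun ring lra.

Import Order.TTheory GRing.Theory Num.Theory.
Import numFieldNormedType.Exports.

Local Open Scope classical_set_scope.
Local Open Scope ring_scope.

(** Compare a quantile $\mu$ of order $\alpha$ in direction $w$, $\|w\|=1$, with
    two other points.

    Against $\mu+w$: minimality says that the mean triangle defect
    $D(\mu,w)=\int(\|z-\mu\|+\|w\|-\|z-\mu-w\|)\,dP(z)\ge 0$ is at most
    $1-\alpha$ ([quantile_mean_defect_le]), so that $D(\mu_n,u_n)\to 0$.  Now
    $D(\mu,u)=0$ forces equality in the triangle inequality for almost every
    $z$, hence $P$ to live on the half-line $\mu-\mathbb{R}_+u$.  This is a line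
    with direction $u$ on which $\|z\|+u'z$ is bounded, so the assumption on
    $P$ gives $D(\cdot,u)>0$ everywhere ([mean_defect_gt0]).  As $D$ is Lipschitz
    in both variables, $D(\cdot,u)$ has a positive minimum on each ball, and
    $D(\mu_n,u_n)\to 0$ is only possible if $\|\mu_n\|\to\infty$
    ([mean_defect_cvg0_unbounded]).

    Against $0$: minimality says that
    $\int(\|z-\mu_n\|-\|z\|)\,dP(z)\le\alpha_n u_n'\mu_n$
    ([quantile_mean_loss_le_dotp]).  Divide by $\|\mu_n\|$ and call the left side
    $I_n$: since $\|\mu_n\|\to\infty$, dominated convergence gives $I_n\to 1$
    ([mean_loss_equiv]).  With $v_n=\mu_n/\|\mu_n\|$ it follows that
    $\|v_n-\alpha_n u_n\|^2\le 2-2\alpha_n u_n'v_n\le 2-2I_n\to 0$, and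
    $\alpha_n u_n\to u$.  No moment of $P$ is involved: all the integrands above
    are bounded by the triangle inequality. *)

(** * Euclidean geometry of row vectors *)

Section Euclid.
Context {R : realType} {d : nat}.
Implicit Types (x y z w : 'rV[R]_d) (a : R).

Lemma dotpC x y : dotp x y = dotp y x.
Proof. by apply: eq_bigr => i _; rewrite mulrC. Qed.

Lemma dotpDl x y z : dotp (x + y) z = dotp x z + dotp y z.
Proof. by rewrite -big_split; apply: eq_bigr => i _; rewrite mxE mulrDl. Qed.

Lemma dotpZl a x y : dotp (a *: x) y = a * dotp x y.
Proof. by rewrite mulr_sumr; apply: eq_bigr => i _; rewrite mxE mulrA. Qed.

Lemma dotpDr x y z : dotp x (y + z) = dotp x y + dotp x z.
Proof. by rewrite dotpC dotpDl !(dotpC x). Qed.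

Lemma dotpZr a x y : dotp x (a *: y) = a * dotp x y.
Proof. by rewrite dotpC dotpZl dotpC. Qed.

Lemma dotpx0 x : dotp x 0 = 0.
Proof. by apply: big1 => i _; rewrite mxE mulr0. Qed.

Lemma dotpxx_ge0 x : 0 <= dotp x x.
Proof. by apply: sumr_ge0 => i _; rewrite -expr2 sqr_ge0. Qed.

Lemma enorm_ge0 x : 0 <= enorm x.
Proof. exact: sqrtr_ge0. Qed.

Lemma sqr_enorm x : enorm x ^+ 2 = dotp x x.
Proof. by rewrite sqr_sqrtr ?dotpxx_ge0. Qed.

Lemma dotpxx_eq0 x : dotp x x = 0 -> x = 0.
Proof.
move/eqP; rewrite psumr_eq0 => [/allP h|i _]; last by rewrite -expr2 sqr_ge0.
apply/rowP => i; rewrite mxE; apply/eqP.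
by have /implyP := h i (mem_index_enum i); rewrite -expr2 sqrf_eq0; apply.
Qed.

Lemma enormZ a x : enorm (a *: x) = `|a| * enorm x.
Proof.
by rewrite /enorm dotpZl dotpZr mulrA -expr2 sqrtrM ?sqr_ge0// sqrtr_sqr.
Qed.

Lemma enorm0 : enorm (0 : 'rV[R]_d) = 0.
Proof. by rewrite -(scale0r 0) enormZ normr0 mul0r. Qed.

Lemma enorm_eq0 x : enorm x = 0 -> x = 0.
Proof. by move=> x0; apply: dotpxx_eq0; rewrite -sqr_enorm x0 expr0n. Qed.

Lemma enormN x : enorm (- x) = enorm x.
Proof. by rewrite -scaleN1r enormZ normrN1 mul1r. Qed.

Lemma enormBC x y : enorm (x - y) = enorm (y - x).
Proof. by rewrite -enormN opprB. Qed.

Lemma sqr_enormB x y :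
  enorm (x - y) ^+ 2 = enorm x ^+ 2 + enorm y ^+ 2 - 2 * dotp x y.
Proof.
rewrite !sqr_enorm -scaleN1r dotpDl !dotpDr !dotpZl !dotpZr (dotpC y x); ring.
Qed.

(** Cauchy-Schwarz, from the nonnegativity of the squared norm of
    $\|y\|x-\|x\|y$. *)
Lemma dotp_le_enorm x y : dotp x y <= enorm x * enorm y.
Proof.
have [x0|x0] := eqVneq (enorm x) 0.
  by rewrite x0 mul0r (enorm_eq0 _ x0) dotpC dotpx0.
have [y0|y0] := eqVneq (enorm y) 0.
  by rewrite y0 mulr0 (enorm_eq0 _ y0) dotpx0.
have := sqr_ge0 (enorm (enorm y *: x - enorm x *: y)).
rewrite sqr_enormB !enormZ !ger0_norm ?enorm_ge0// dotpZl dotpZr => h.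
have p : 0 < enorm x * enorm y by rewrite mulr_gt0// lt0r ?x0 ?y0 enorm_ge0.
rewrite -(ler_pM2l p); nra.
Qed.

Lemma ler_enormD x y : enorm (x + y) <= enorm x + enorm y.
Proof.
rewrite -(@ler_pXn2r _ 2)// ?nnegrE ?addr_ge0 ?enorm_ge0//.
rewrite -{1}(opprK y) sqr_enormB enormN -(scaleN1r y) dotpZr.
by have := dotp_le_enorm x y; nra.
Qed.

Lemma ler_enormB x y : enorm (x - y) <= enorm x + enorm y.
Proof. by rewrite -(enormN y) ler_enormD. Qed.

Lemma ler_dist_enorm x y : `|enorm x - enorm y| <= enorm (x - y).
Proof.
have := ler_enormD (x - y) y; have := ler_enormD (y - x) x.
by rewrite !subrK (enormBC y x) ler_norml => h1 h2; apply/andP; split; lra.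
Qed.

Lemma dotp_continuous (f g : 'rV[R]_d -> 'rV[R]_d) :
  continuous f -> continuous g -> continuous (fun z => dotp (f z) (g z)).
Proof.
move=> cf cg; apply: continuous_big => [|i _ z]; first exact: add_continuous.
have ci (h : 'rV[R]_d -> 'rV[R]_d) : continuous h ->
    h x 0 i @[x --> z] --> h z 0 i.
  move=> ch; apply: (@continuous_comp _ _ _ h (fun M : 'rV[R]_d => M 0 i)).
    exact: ch.
  exact: coord_continuous.

exact: (cvgM (ci f cf) (ci g cg)).
Qed.

Lemma enorm_continuous : continuous (@enorm R d).
Proof.
move=> z; apply: (@continuous_comp _ _ _ (fun x => dotp x x) (@Num.sqrt R)).
  by apply: (@dotp_continuous id id) => ?; exact: cvg_id.
exact: sqrt_continuous.
Qed.

Lemma normr_le_enorm x : `|x| <= enorm x.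
Proof.
rewrite [leLHS]/Num.norm /= mx_normrE; apply/bigmax_leP; split=> [|[i j] _ /=].
  exact: enorm_ge0.
rewrite -sqrtr_sqr ler_sqrt ?dotpxx_ge0// ord1 /dotp (bigD1 j)//= expr2 lerDl.
by apply: sumr_ge0 => k _; rewrite -expr2 sqr_ge0.
Qed.

(** Convergence of row vectors refers to the sup norm, which the Euclidean norm
    dominates. *)
Lemma cvg_enormB0 (x_ : nat -> 'rV[R]_d) x :
  enorm (x_ n - x) @[n --> \oo] --> 0 -> x_ n @[n --> \oo] --> x.
Proof.
move=> /cvgr0_norm_lt h; apply/cvgrPdistC_lt => e /h; apply: filterS => n.
rewrite ger0_norm ?enorm_ge0//; exact/le_lt_trans/normr_le_enorm.
Qed.

End Euclid.

(** * The triangle defect and its mean *)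

Section Defect.
Context {R : realType} {d : nat}.
Implicit Types (x y z w mu u : 'rV[R]_d) (P : probability (borel_rV R d) R).

Definition triangle_defect x w : R := enorm x + enorm w - enorm (x - w).

Lemma triangle_defect_ge0 x w : 0 <= triangle_defect x w.
Proof. by rewrite subr_ge0 ler_enormB. Qed.

Lemma triangle_defect_le x w : triangle_defect x w <= 2 * enorm w.
Proof.
rewrite /triangle_defect; have := ler_enormD (x - w) w; rewrite subrK; lra.
Qed.

(** The Lipschitz bounds of the defect, in each of its arguments, pass to its
    mean and are what makes a compactness argument possible. *)
Lemma triangle_defect_lipl x y w :
  `|triangle_defect x w - triangle_defect y w| <= 2 * enorm (x - y).
Proof.
have := ler_dist_enorm x y; have := ler_dist_enorm (x - w) (y - w).
rewrite (_ : x - w - (y - w) = x - y); last by rewrite opprB addrA subrK.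
rewrite /triangle_defect !ler_norml => /andP[h1 h2] /andP[h3 h4].
by apply/andP; split; lra.
Qed.

Lemma triangle_defect_lipr x v w :
  `|triangle_defect x v - triangle_defect x w| <= 2 * enorm (v - w).
Proof.
have := ler_dist_enorm v w; have := ler_dist_enorm (x - v) (x - w).
rewrite (_ : x - v - (x - w) = w - v); last first.
  by rewrite opprB addrC addrA subrK.
rewrite (enormBC w) /triangle_defect !ler_norml => /andP[h1 h2] /andP[h3 h4].
by apply/andP; split; lra.
Qed.

(** Squaring $\|x-u\|=\|x\|+1$ gives $u'x=-\|x\|$, the equality case of
    Cauchy-Schwarz, whence $\|x+\|x\|u\|=0$. *)
Lemma triangle_defect_eq0 x u : enorm u = 1 -> triangle_defect x u = 0 ->
  x = - enorm x *: u.
Proof.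
move=> u1 /eqP; rewrite /triangle_defect u1 subr_eq0 => /eqP e.
have := sqr_enormB x u; rewrite -e u1 => e2.
apply/eqP; rewrite scaleNr -addr_eq0; apply/eqP/enorm_eq0/eqP.
rewrite -sqrf_eq0 -[_ *: u]opprK sqr_enormB enormN enormZ u1.
rewrite ger0_norm ?enorm_ge0// -(scaleNr (enorm x) u) dotpZr; apply/eqP; nra.
Qed.

Lemma continuous_measurable_borel_rV (f : 'rV[R]_d -> R) :
  continuous f -> measurable_fun setT (f : borel_rV R d -> R).
Proof.
move=> /continuousP cf; apply: (measurability _ (RGenOpens.measurableE R)).
move=> _ [_ [a [b ->] <-]]; rewrite setTI; apply: sub_sigma_algebra.
exact/cf/interval_open.
Qed.

(** The source of all integrability below, whatever the tails of $P$. *)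
Lemma integrable_continuous_bounded P (f : 'rV[R]_d -> R) (M : R) :
  continuous f -> (forall z, `|f z| <= M) ->
  P.-integrable setT (EFin \o (f : borel_rV R d -> R)).
Proof.
move=> cf fM; apply: measurable_bounded_integrable => //.
- by rewrite (le_lt_trans (probability_le1 P measurableT))// ltry.
- exact: continuous_measurable_borel_rV.
- exists M; split; first exact: num_real.
  by move=> N MN z _ /=; exact: le_trans (fM z) (ltW MN).
Qed.

Lemma subr_continuous x : continuous (fun z : 'rV[R]_d => z - x).
Proof. by move=> z; exact: (cvgB cvg_id (cvg_cst x)). Qed.

Lemma enormB_continuous x : continuous (fun z => enorm (z - x)).
Proof.
have c := subr_continuous x.
move=> z; apply: (@continuous_comp _ _ _ (fun z => dotp (z - x) (z - x))).
  exact: dotp_continuous.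
exact: sqrt_continuous.
Qed.

Lemma triangle_defect_continuous mu w :
  continuous (fun z => triangle_defect (z - mu) w).
Proof.
move=> z; rewrite /triangle_defect.
under eq_fun do rewrite -(addrA _ (- mu)) -opprD.
exact: (cvgB (cvgD (@enormB_continuous mu z) (cvg_cst _))
             (@enormB_continuous (mu + w) z)).
Qed.

Lemma integrable_triangle_defect P mu w : P.-integrable setT
  (EFin \o (fun z : borel_rV R d => triangle_defect (z - mu) w)).
Proof.
apply: (@integrable_continuous_bounded _ _ (2 * enorm w)).
  exact: triangle_defect_continuous.
by move=> z; rewrite ger0_norm ?triangle_defect_ge0 ?triangle_defect_le.
Qed.

Definition mean_defect P mu w : R := \int[P]_z triangle_defect (z - mu) w.

Lemma ler_dist_Rintegral P (f g : borel_rV R d -> R) (c : R) :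
  P.-integrable setT (EFin \o f) -> P.-integrable setT (EFin \o g) ->
  (forall z, `|f z - g z| <= c) ->
  `|\int[P]_z f z - \int[P]_z g z| <= c.
Proof.
move=> fi gi fg; rewrite -RintegralB//.
have bi : P.-integrable setT (EFin \o (fun z => f z - g z)).
  exact: (@integrableB _ _ _ P _ measurableT _ _ fi gi).
apply: le_trans (le_normr_Rintegral _ bi) _ => //.
rewrite -[leRHS]mulr1 -[X in c * X]/(fine 1%E) -(probability_setT P).
rewrite -Rintegral_cst//; apply: le_Rintegral => //.
  exact: integrable_norm.
exact: finite_measure_integrable_cst.
Qed.

Lemma mean_defect_lipl P mu nu w :
  `|mean_defect P mu w - mean_defect P nu w| <= 2 * enorm (mu - nu).
Proof.
apply: ler_dist_Rintegral => [||z]; [exact: integrable_triangle_defect..|].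
apply: le_trans (triangle_defect_lipl _ _ _) _.
by rewrite opprB addrC addrA subrK enormBC.
Qed.

Lemma mean_defect_lipr P mu v w :
  `|mean_defect P mu v - mean_defect P mu w| <= 2 * enorm (v - w).
Proof.
apply: ler_dist_Rintegral => [||z]; [exact: integrable_triangle_defect..|].
exact: triangle_defect_lipr.
Qed.

Lemma mean_defect_ge0 P mu w : 0 <= mean_defect P mu w.
Proof. by apply: Rintegral_ge0 => z _; exact: triangle_defect_ge0. Qed.

Lemma mean_defect_continuous P w : continuous (mean_defect P ^~ w).
Proof.
move=> mu; apply/(@cvgrPdist_le _ _ _ (nbhs mu) (nbhs_filter mu)) => e e0.
have := enormB_continuous mu mu.
rewrite /continuous_at subrr enorm0 => /cvgr0_norm_lt /(_ (e / 2)).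
rewrite divr_gt0// => /(_ isT); apply: filterS => nu.
rewrite ger0_norm ?enorm_ge0// enormBC => h.
by apply: le_trans (mean_defect_lipl _ _ _ _) _; lra.
Qed.


(** * The mean defect vanishes only on half-lines *)

(** The line is the zero set of the continuous function of $z$ that measures
    the squared distance of $z$ to it. *)
Lemma line_measurable mu u : enorm u = 1 ->
  measurable ([set mu + lambda *: u | lambda in [set: R]] : set (borel_rV R d)).
Proof.
move=> u1.
have cmu := subr_continuous mu.
(* $\|z-\mu\|^2-(u'(z-\mu))^2$, zero exactly on the line as $\|u\|=1$ *)
pose q (z : 'rV[R]_d) :=
  dotp (z - mu) (z - mu) - dotp (z - mu) u * dotp (z - mu) u.
have cq : continuous q.
  have cu : continuous (fun _ : 'rV[R]_d => u).
    exact: cst_continuous.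
  move=> z.
  have c1 := @dotp_continuous _ _ _ _ cmu cmu z.
  have c2 := @dotp_continuous _ _ _ _ cmu cu z.
  exact: (cvgB c1 (cvgM c2 c2)).
rewrite [X in measurable X](_ : _ =
    setT `&` (q : borel_rV R d -> R) @^-1` [set 0]).
  exact: (continuous_measurable_borel_rV _ cq measurableT _ (measurable_set1 _)).
rewrite setTI; apply/seteqP; split=> z /=.
  move=> [l _ <-]; rewrite /q addrAC subrr add0r !dotpZl dotpZr -sqr_enorm u1.
  by ring.
move=> qz; exists (dotp (z - mu) u) => //.
suff /enorm_eq0 : enorm (z - mu - dotp (z - mu) u *: u) = 0.
  by move=> /subr0_eq <-; rewrite addrC subrK.
apply/eqP; rewrite -sqrf_eq0 sqr_enormB sqr_enorm enormZ u1 dotpZr; apply/eqP.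
by rewrite mulr1 -normrX ger0_norm ?sqr_ge0//; move: qz; rewrite /q; lra.
Qed.

Lemma mean_defect_eq0_ae P mu u : mean_defect P mu u = 0 ->
  {ae P, forall z, triangle_defect (z - mu) u = 0}.
Proof.
move=> m0.
have mf := continuous_measurable_borel_rV _ (triangle_defect_continuous mu u).
have mE : measurable_fun [set: borel_rV R d]
    (fun z : borel_rV R d => (triangle_defect (z - mu) u)%:E).
  exact/measurable_EFinP.
suff /(ae_eq_integral_abs P measurableT mE) : (\int[P]_z
    `|(triangle_defect (z - mu) u)%:E| = 0)%E.
  by apply: filterS => z /(_ I) [].
under eq_integral do rewrite gee0_abs ?lee_fin ?triangle_defect_ge0//.
have := integrable_fin_num measurableT (integrable_triangle_defect P mu u).
by move=> /fineK <-; rewrite -[fine _]/(mean_defect P mu u) m0.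
Qed.

Lemma enormD_dotp_ge0 u z : enorm u = 1 -> 0 <= enorm z + dotp u z.
Proof.
move=> u1; have := dotp_le_enorm (- u) z.
by rewrite enormN u1 -scaleN1r dotpZl; lra.
Qed.

(** Almost surely $z=\mu-su$ with $s=\|z-\mu\|\ge 0$, so that
    $\|z\|+u'z\le(\|\mu\|+s)+(u'\mu-s)$: the two unbounded terms cancel because
    $P$ charges only the half pointing in direction $-u$. *)
Lemma mean_defect_eq0 P mu u : enorm u = 1 -> mean_defect P mu u = 0 ->
  concentrated_on_line P u /\ (\int[P]_z (enorm z + dotp u z)%:E < +oo)%E.
Proof.
move=> u1 /mean_defect_eq0_ae ae0.
have zE z : triangle_defect (z - mu) u = 0 -> z = mu - enorm (z - mu) *: u.
  move=> /(triangle_defect_eq0 _ _ u1); rewrite scaleNr => <-.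
  by rewrite addrC subrK.
have mL := line_measurable mu u u1; split.
  exists mu; apply/eqP; rewrite eq_le probability_le1//=.
  have [N [mN PN sN]] := ae0.
  rewrite -[1%E](sube0) -PN -probability_setC//.
  apply: le_measure; rewrite ?inE//; first exact: measurableC.
  move=> z Nz; exists (- enorm (z - mu)) => //; rewrite scaleNr -zE//.
  by apply: contrapT => h; apply/Nz/sN.
have cs : continuous (fun z : 'rV[R]_d => enorm z + dotp u z).
  have cu : continuous (fun _ : 'rV[R]_d => u) by exact: cst_continuous.
  have ci : continuous (fun z : 'rV[R]_d => z) by move=> z; exact: cvg_id.
  have cd := @dotp_continuous _ _ _ _ cu ci.
  by move=> z; exact: (cvgD (@enorm_continuous _ _ z) (cd z)).
apply: (@le_lt_trans _ _ (\int[P]_z (enorm mu + dotp u mu)%:E)%E).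
  apply: ae_ge0_le_integral => //.
  - by move=> z _; rewrite lee_fin enormD_dotp_ge0.
  - have := continuous_measurable_borel_rV _ cs.
    by move=> /measurable_EFinP.
  - by move=> z _; rewrite lee_fin enormD_dotp_ge0.
  - have [N [mN PN sN]] := ae0; exists N; split=> // z /= h; apply: sN => /= dz.
    apply: h => _; rewrite [z]zE// lee_fin.
    have := ler_enormB mu (enorm (z - mu) *: u).
    rewrite enormZ u1 mulr1 ger0_norm ?enorm_ge0// dotpDr -scaleNr dotpZr.
    by rewrite -sqr_enorm u1; lra.
rewrite integral_cst// [X in (_ * X)%E]probability_setT mule1 ltry.
exact: isT.
Qed.

(** * Comparison inequalities for quantiles *)

(** The quantile objective without its linear term; working with real numbers
    is harmless because the integrand is bounded by the norm of [mu]. *)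
Definition mean_loss P mu : R := \int[P]_z (enorm (z - mu) - enorm z).

Lemma loss_continuous mu : continuous (fun z => enorm (z - mu) - enorm z).
Proof.
by move=> z; exact: (cvgB (@enormB_continuous mu z) (@enorm_continuous _ _ z)).
Qed.

Lemma loss_le mu z : `|enorm (z - mu) - enorm z| <= enorm mu.
Proof.
have := ler_dist_enorm (z - mu) z.
by rewrite addrAC subrr add0r enormN.
Qed.

Lemma integrable_loss P mu : P.-integrable setT
  (EFin \o (fun z : borel_rV R d => enorm (z - mu) - enorm z)).
Proof.
exact: (integrable_continuous_bounded _ _ _ (loss_continuous mu) (loss_le mu)).
Qed.

Lemma quantile_objectiveE P (a : R) u mu :
  quantile_objective P a u mu = (mean_loss P mu - a * dotp u mu)%:E.
Proof.
have il := integrable_loss P mu.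
have ic := finite_measure_integrable_cst P (a * dotp u mu) measurableT.
have ib : P.-integrable setT (EFin \o (fun z : borel_rV R d =>
    enorm (z - mu) - enorm z - a * dotp u mu)).
  exact: (@integrableB _ _ _ P _ measurableT _ _ il ic).
rewrite /quantile_objective -[LHS]fineK ?(integrable_fin_num _ ib)//.
rewrite -/(Rintegral _ _ _) RintegralB// Rintegral_cst//.
by rewrite [fine _](congr1 fine (probability_setT P)) mulr1.
Qed.

Lemma mean_defectE P mu w :
  mean_defect P mu w = mean_loss P mu - mean_loss P (mu + w) + enorm w.
Proof.
have i1 := integrable_loss P mu; have i2 := integrable_loss P (mu + w).
have ic := finite_measure_integrable_cst P (enorm w) measurableT.
have ib : P.-integrable setT (EFin \o (fun z : borel_rV R d =>
    enorm (z - mu) - enorm z - (enorm (z - (mu + w)) - enorm z))).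
  exact: (@integrableB _ _ _ P _ measurableT _ _ i1 i2).
rewrite -[enorm w]mulr1 -[X in _ * X]/(fine 1%E) -(probability_setT P).
rewrite -Rintegral_cst// -RintegralB// -RintegralD//.
apply: eq_Rintegral => z _.
by rewrite /triangle_defect /cst (opprD mu) (addrA z); ring.
Qed.

Lemma quantile_mean_loss_le P (a : R) u mu nu : is_spatial_quantile P a u mu ->
  mean_loss P mu - a * dotp u mu <= mean_loss P nu - a * dotp u nu.
Proof. by move=> /(_ nu); rewrite !quantile_objectiveE lee_fin. Qed.

(** Moving from $\mu$ to $\mu+u$ cannot lower the objective. *)
Lemma quantile_mean_defect_le P (a : R) u mu : enorm u = 1 ->
  is_spatial_quantile P a u mu -> mean_defect P mu u <= 1 - a.
Proof.
move=> u1 /(quantile_mean_loss_le _ _ _ _ (mu + u)).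
by rewrite mean_defectE u1 dotpDr -(sqr_enorm u) u1; lra.
Qed.

(** The objective vanishes at $0$. *)
Lemma quantile_mean_loss_le_dotp P (a : R) u mu :
  is_spatial_quantile P a u mu -> mean_loss P mu <= a * dotp u mu.
Proof.
move=> /(quantile_mean_loss_le _ _ _ _ 0).
have -> : mean_loss P 0 = 0.
  rewrite /mean_loss; under eq_Rintegral do rewrite subr0 subrr.
  by rewrite Rintegral_cst// mul0r.
by rewrite dotpx0; lra.
Qed.


(** * Quantiles of extreme order *)

Lemma mean_defect_gt0 P u mu : enorm u = 1 ->
  ~ concentrated_on_line P u \/ (\int[P]_z (enorm z + dotp u z)%:E = +oo)%E ->
  0 < mean_defect P mu u.
Proof.
move=> u1 hP; rewrite lt_neqAle mean_defect_ge0 andbT eq_sym; apply/eqP => m0.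
have [cl fi] := mean_defect_eq0 P mu u u1 m0.
by case: hP => [/(_ cl)//|ioo]; rewrite ioo ltxx in fi.
Qed.

Lemma enorm_ball_compact (M : R) : compact [set x : 'rV[R]_d | enorm x <= M].
Proof.
apply: bounded_closed_compact.
  exists M; split; first exact: num_real.
  move=> N MN x /= xM; apply: le_trans (normr_le_enorm x) _.
  exact: le_trans xM (ltW MN).
rewrite (_ : [set x | _] = @enorm R d @^-1` [set r | r <= M])//.
by apply: closed_comp => [x _|]; [exact: enorm_continuous|exact: closed_le].
Qed.

(** On a ball the mean defect in direction $u$ is at least some $m>0$; a point
    $\mu_n$ of the ball then has mean defect at least $m-2\|u_n-u\|$ in direction
    $u_n$, which is impossible for large $n$. *)
Lemma mean_defect_cvg0_unbounded P u (u_ mu : nat -> 'rV[R]_d) :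
  (forall m, 0 < mean_defect P m u) ->
  enorm (u_ n - u) @[n --> \oo] --> 0 ->
  mean_defect P (mu n) (u_ n) @[n --> \oo] --> 0 ->
  enorm (mu n) @[n --> \oo] --> +oo.
Proof.
move=> dpos /cvgr0_norm_lt uu /cvgr0_norm_lt d0; apply/cvgryPgt => M.
have [] := @EVT_min_rV R d (mean_defect P ^~ u) [set x | enorm x <= `|M|].
- by exists 0; rewrite /= enorm0.
- exact: enorm_ball_compact.
- exact/continuous_subspaceT/mean_defect_continuous.
move=> c _ cmin; have e0 := dpos c.
(* A quarter of the minimum covers the defect of $\mu_n$, and two more quarters
   the Lipschitz term. *)
have e2 : 0 < mean_defect P c u / 4 by rewrite divr_gt0.
near=> n.
rewrite ltNge; apply/negP => nM.
have : mean_defect P c u <= mean_defect P (mu n) u.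
  by apply: cmin; rewrite inE /=; exact: le_trans nM (ler_norm _).
have := mean_defect_lipr P (mu n) (u_ n) u.
have : `|mean_defect P (mu n) (u_ n)| < mean_defect P c u / 4.
  by near: n; exact: d0.
have : `|enorm (u_ n - u)| < mean_defect P c u / 4.
  by near: n; exact: uu.
rewrite ger0_norm ?enorm_ge0// ger0_norm ?mean_defect_ge0// ler_norml.
by move=> h1 h2 /andP[h3 _] h4; lra.
Unshelve. all: by end_near. Qed.

(** Seen from far away $\|z-\mu\|-\|z\|$ is nearly $\|\mu\|$: the ratio is at most
    $1$ in absolute value and differs from $1$ by at most $2\|z\|/\|\mu\|$. *)
Lemma mean_loss_equiv P (mu : nat -> 'rV[R]_d) :
  enorm (mu n) @[n --> \oo] --> +oo ->
  (enorm (mu n))^-1 * mean_loss P (mu n) @[n --> \oo] --> (1 : R).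
Proof.
move=> /cvgryPgt muoo.
pose f n (z : borel_rV R d) :=
  (enorm (mu n))^-1 * (enorm (z - mu n) - enorm z).
have cf n : continuous (f n).
  by move=> z; exact: (cvgM (cvg_cst _) (loss_continuous (mu n) z)).
have f1 n z : `|f n z| <= 1.
  rewrite normrM ger0_norm ?invr_ge0 ?enorm_ge0//.
  have [->|m0] := eqVneq (enorm (mu n)) 0; first by rewrite invr0 mul0r.
  by rewrite ler_pdivrMl ?mulr1 ?loss_le// lt0r m0 enorm_ge0.
have fcvg z : f n z @[n --> \oo] --> (1 : R).
  apply/cvgrPdist_lt => e e0; near=> n.
  have h : 2 * enorm z / e < enorm (mu n) by near: n; exact: muoo.
  have m0 : 0 < enorm (mu n).
    by apply: le_lt_trans h; rewrite divr_ge0 ?mulr_ge0 ?enorm_ge0// ltW.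
  have -> : 1 - f n z =
      (enorm (mu n))^-1 * (enorm (mu n) - (enorm (z - mu n) - enorm z)).
    by rewrite mulrBr mulVf ?gt_eqF.
  rewrite normrM gtr0_norm ?invr_gt0// ltr_pdivrMl//.
  rewrite ltr_pdivrMr// in h; apply: le_lt_trans h.
  have h1 := ler_enormB z (mu n).
  have h2 := ler_enormB z (z - mu n); rewrite opprB addrC subrK in h2.
  by rewrite ler_norml; apply/andP; split; lra.
have [] := @dominated_convergence _ _ _ P _ measurableT
  (fun n z => (f n z)%:E) (cst 1%E) (cst 1%E).
- move=> n.
  by have /measurable_EFinP := continuous_measurable_borel_rV _ (cf n).
- exact: measurable_cst.
- by apply: aeW => z _; apply: cvg_EFin; [exact: nearW|exact: fcvg].
- exact: (finite_measure_integrable_cst P 1 measurableT).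
- by apply: aeW => z n _; rewrite lee_fin f1.
move=> _ _; rewrite integral_cst// mul1e [X in _ --> X]probability_setT.
move=> /fine_cvg; rewrite (_ : fine \o _ =
  (fun n => (enorm (mu n))^-1 * mean_loss P (mu n)))//.
by apply/funext => n /=; rewrite -RintegralZl//; exact: integrable_loss.
Unshelve. all: by end_near. Qed.

End Defect.

Theorem theorem3 (R : realType) (d : nat) (P : probability (borel_rV R d) R)
    (alpha : nat -> R) (u_ : nat -> 'rV[R]_d) (u : 'rV[R]_d)
    (alpha_ge0_lt1 : forall n, 0 <= alpha n < 1)
    (alpha_cvg : alpha n @[n --> \oo] --> (1 : R))
    (u_sphere : forall n, unit_sphere (u_ n))
    (u_cvg : u_ n @[n --> \oo] --> u)
    (P_hyp : ~ concentrated_on_line P u \/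
             (\int[P]_z (enorm z + dotp u z)%:E = +oo)%E) :
  forall mu : nat -> 'rV[R]_d,
    (forall n, is_spatial_quantile P (alpha n) (u_ n) (mu n)) ->
    (enorm (mu n))^-1 *: mu n @[n --> \oo] --> u.
Proof.
move=> mu qmu.
have uu0 : enorm (u_ n - u) @[n --> \oo] --> (0 : R).
  have := cvg_comp _ _ u_cvg (@enormB_continuous _ _ u u).
  by rewrite subrr enorm0.
have u1 : enorm u = 1.
  have : enorm (u_ n) @[n --> \oo] --> enorm u.
    exact: (cvg_comp _ _ u_cvg (@enorm_continuous R d u)).
  under eq_fun do rewrite u_sphere.
  by move=> e; rewrite -(cvg_lim _ e)// lim_cst.
have alpha0 : 1 - alpha n @[n --> \oo] --> (0 : R).
  by rewrite -(subrr 1); exact: (cvgB (cvg_cst _) alpha_cvg).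
have muoo : enorm (mu n) @[n --> \oo] --> +oo.
  apply: (@mean_defect_cvg0_unbounded _ _ P u u_ mu) => //.
    by move=> m; exact: mean_defect_gt0.
  apply: (@squeeze_cvgr _ _ _ _ (cst 0) (fun n => 1 - alpha n)) => //.
    apply: nearW => n; rewrite mean_defect_ge0/=.
    exact: (quantile_mean_defect_le _ _ _ _ (u_sphere n) (qmu n)).
  exact: cvg_cst.
pose I n := (enorm (mu n))^-1 * mean_loss P (mu n).
have I1 : I n @[n --> \oo] --> (1 : R) by exact: mean_loss_equiv.
pose v n := (enorm (mu n))^-1 *: mu n.
(* Only an inequality: $v_n=0$ for the finitely many $n$ with $\mu_n=0$. *)
have v_le1 n : enorm (v n) <= 1.
  rewrite enormZ ger0_norm ?invr_ge0 ?enorm_ge0//.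
  have [->|m0] := eqVneq (enorm (mu n)) 0; first by rewrite mulr0.
  by rewrite mulVf.
have av n : enorm (v n - alpha n *: u_ n) <= Num.sqrt (2 - 2 * I n).
  rewrite -[leLHS]ger0_norm ?enorm_ge0// -sqrtr_sqr ler_wsqrtr//.
  have In : I n <= alpha n * dotp (v n) (u_ n).
    rewrite /I /v dotpZl mulrCA ler_wpM2l ?invr_ge0 ?enorm_ge0//.
    by rewrite dotpC quantile_mean_loss_le_dotp.
  have /andP[a0 a1] := alpha_ge0_lt1 n.
  rewrite sqr_enormB enormZ u_sphere mulr1 dotpZr real_normK ?num_real//.
  have := v_le1 n; have := enorm_ge0 (v n); nra.
have dist n : enorm (v n - u) <=
    Num.sqrt (2 - 2 * I n) + (1 - alpha n) + enorm (u_ n - u).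
  have /andP[a0 a1] := alpha_ge0_lt1 n.
  have -> : v n - u = (v n - alpha n *: u_ n) + (alpha n - 1) *: u_ n
                      + (u_ n - u).
    by rewrite scalerBl scale1r (addrA (v n - _)) subrK addrA subrK.
  apply: le_trans (ler_enormD _ _) _; rewrite lerD2r.
  apply: le_trans (ler_enormD _ _) _; apply: lerD => //.
  rewrite enormZ u_sphere mulr1 ler0_norm ?opprB//.
  by rewrite subr_le0 ltW.
apply: cvg_enormB0.
apply: (@squeeze_cvgr _ _ _ _ (cst 0) (fun n =>
  Num.sqrt (2 - 2 * I n) + (1 - alpha n) + enorm (u_ n - u))) => //.
- by apply: nearW => n; rewrite enorm_ge0 dist.
- exact: cvg_cst.
rewrite -(addr0 0) -{1}(addr0 0); apply: cvgD => //; apply: cvgD => //.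
have I0 : 2 - 2 * I n @[n --> \oo] --> (0 : R).
  have e : (2 : R) - 2 * 1 = 0 by rewrite mulr1 subrr.
  by rewrite -e; exact: (cvgB (cvg_cst _) (cvgM (cvg_cst _) I1)).
by have := cvg_comp _ _ I0 (@sqrt_continuous R 0); rewrite sqrtr0.
Qed.
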